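(* Let $G$ be a graph with $m$ edges and with no isolated vertices such that $\rho(G)\geq \sqrt{m}$ and $G$ is not isomorphic to any complete bipartite graph. Then $bk(G)\geq \frac{\rho(G)}{3}$.
   Context: Graphs are finite, simple, undirected and have at least one vertex. $\rho(G)$ denotes the spectral radius of $G$, i.e. the largest eigenvalue of its adjacency matrix. A book of size $k$ is a collection of $k$ triangles sharing a common edge; $bk(G)$ denotes the maximum size of a book contained in $G$, i.e. the maximum over edges $uv\in E(G)$ of the number of common neighbours of $u$ and $v$ (and $bk(G)=0$ if $G$ has no triangle). *)

(* Defs.v *)
From HB Require Import structures.
From mathcomp Require Import all_boot all_order all_algebra.
From mathcomp Require Import classical_sets reals.

Set Implicit Arguments.
Unset Strict Implicit.
Unset Printing Implicit Defensive.

Import Order.TTheory GRing.Theory Num.Theory.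
Local Open Scope ring_scope.

Record sgraph := SGraph {
  vertex :> finType;
  adj : rel vertex;
  adj_sym : symmetric adj;
  adj_irrefl : irreflexive adj }.

Definition edges (G : sgraph) : {set {set G}} :=
  [set [set p.1; p.2] | p : G * G & adj p.1 p.2].

Definition no_isolated_vertex (G : sgraph) : Prop :=
  forall x : G, exists y : G, adj x y.

Definition adjacency_matrix (R : realType) (G : sgraph) : 'M[R]_#|G| :=
  \matrix_(i, j) (adj (enum_val i : G) (enum_val j : G))%:R.

(* The adjacency matrix is symmetric, so for a graph with at least one vertex
   the set of its real eigenvalues is nonempty; being finite as well, it has a
   maximum, which is then its [sup]. *)
Definition spectral_radius (R : realType) (G : sgraph) : R :=
  sup [set a : R | eigenvalue (adjacency_matrix R G) a]%classic.

Definition common_neighbours (G : sgraph) (u v : G) : {set G} :=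
  [set w : G | adj u w && adj v w].

(* The maximum over an empty family is 0, so an edgeless graph gets 0. *)
Definition bk (G : sgraph) : nat :=
  \max_(p : G * G | adj p.1 p.2) #|common_neighbours p.1 p.2|.

Definition isomorphic (G H : sgraph) : Prop :=
  exists2 f : G -> H, bijective f & forall x y : G, adj (f x) (f y) = adj x y.

Definition Kst_rel (s t : nat) : rel ('I_s + 'I_t) :=
  fun x y => match x, y with
             | inl _, inr _ | inr _, inl _ => true
             | _, _ => false
             end.

Fact Kst_sym (s t : nat) : symmetric (@Kst_rel s t).
Proof. by case=> x [] y. Qed.

Fact Kst_irrefl (s t : nat) : irreflexive (@Kst_rel s t).
Proof. by case. Qed.

Definition complete_bipartite (s t : nat) : sgraph :=
  SGraph (@Kst_sym s t) (@Kst_irrefl s t).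

(* Main.v *)
Require Import Defs.
From mathcomp Require Import all_boot all_order all_algebra.
From mathcomp Require Import ring lra.
From mathcomp Require Import boolp classical_sets functions reals.
From mathcomp Require Import topology normedtype derive.

Import Order.TTheory GRing.Theory Num.Theory.
Import numFieldNormedType.Exports.
Local Open Scope ring_scope.

(** Why a graph with [rho ^ 2 >= m] has a book of size at least [rho / 3].

    Write [b] for the book size, [r] for the spectral radius and [f] for a
    nonnegative eigenvector of [r].  The two quantities to compare are
    - [I = inner_weight f], the sum over vertices [u] of [f u] times the number
      of (ordered) edges with both ends in [N(u)];
    - [O = outer_weight f], the same sum over edges with no end in [N(u)].
    For each [u], the edges inside [N(u)] outnumber those outside it by exactly
    the sum of the degrees over [N(u)] minus [m]; weighting with the eigenvector
    turns this into the identity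
    [I - O = 2 (r ^ 2 - m) * \sum_u f u], so that [O <= I]
    ([inner_weight_sub_outer]).

    Books enter through pairs made of a triangle [yzw] and a vertex [u].  Let
    [p], [q], [s] be the 0-1 adjacencies of [u] to the three corners.  Whatever
    their values,
    [p + q + s <= 2 (p q + q s + s p) + ((1-p)(1-q) + (1-q)(1-s) + (1-s)(1-p))].
    Multiply by [f u] and sum over all [u] and all triangles.  The eigenvector
    equation makes the left side [r * I], up to a common factor.  On the
    right, a term [p q] pairs the triangle [uyz] with a page [w] of the book on
    [yz], and a term [(1-p)(1-q)] pairs an edge [yz] far from [u] with such a
    page; each has at most [b] choices of [w].  Hence
    [r * I <= b * (2 I + O) <= 3 b * I] ([book_inequality]), which is the claim
    when [I > 0].

    If [I = 0] then [O = 0] as well, and every vertex of positive weight has an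
    independent neighbourhood and an independent non-neighbourhood.  Without
    isolated vertices this forces a complete bipartite graph
    ([complete_bipartite_of_weights]). *)

(** * A nonnegative eigenvector for the largest eigenvalue *)

Definition dot {R : realType} {n : nat} (u v : 'rV[R]_n) : R :=
  \sum_i u 0 i * v 0 i.

Lemma dotC (R : realType) n (u v : 'rV[R]_n) : dot u v = dot v u.
Proof. by apply: eq_bigr => i _; rewrite mulrC. Qed.

Lemma dotDr (R : realType) n (u v w : 'rV[R]_n) :
  dot u (v + w) = dot u v + dot u w.
Proof. by rewrite -big_split; apply: eq_bigr => i _; rewrite mxE mulrDr. Qed.

Lemma dotZr (R : realType) n c (u v : 'rV[R]_n) :
  dot u (c *: v) = c * dot u v.
Proof. by rewrite mulr_sumr; apply: eq_bigr => i _; rewrite mxE mulrCA. Qed.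

Lemma dot0r (R : realType) n (u : 'rV[R]_n) : dot u 0 = 0.
Proof. by rewrite -(scale0r u) dotZr mul0r. Qed.

Lemma dotDl (R : realType) n (u v w : 'rV[R]_n) :
  dot (u + v) w = dot u w + dot v w.
Proof. by rewrite dotC dotDr !(dotC _ _ w). Qed.

Lemma dotZl (R : realType) n c (u v : 'rV[R]_n) :
  dot (c *: u) v = c * dot u v.
Proof. by rewrite dotC dotZr dotC. Qed.

Lemma dot_ge0 (R : realType) n (u : 'rV[R]_n) : 0 <= dot u u.
Proof. by apply: sumr_ge0 => i _; rewrite -expr2 sqr_ge0. Qed.

Lemma dot_eq0 (R : realType) n (u : 'rV[R]_n) : (dot u u == 0) = (u == 0).
Proof.
apply/idP/eqP => [|->]; last by rewrite dot0r.
rewrite psumr_eq0 => [/allP u0|i _]; last by rewrite -expr2 sqr_ge0.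
apply/rowP => i; rewrite mxE.
by have := u0 i (mem_index_enum _); rewrite -expr2 sqrf_eq0 => /eqP.
Qed.

Lemma dot_mulmx (R : realType) n (M : 'M[R]_n) (u v : 'rV[R]_n) :
  dot (u *m M) v = \sum_i \sum_j u 0 i * M i j * v 0 j.
Proof.
rewrite exchange_big; apply: eq_bigr => j _.
by rewrite mxE mulr_suml.
Qed.

Lemma dot_mulmx_sym (R : realType) n (M : 'M[R]_n) (u v : 'rV[R]_n) :
  M^T = M -> dot (u *m M) v = dot (v *m M) u.
Proof.
move=> MT; rewrite !dot_mulmx exchange_big.
apply: eq_bigr => i _; apply: eq_bigr => j _.
by rewrite -{1}MT mxE mulrC mulrA mulrAC.
Qed.

Lemma quadratic_form_continuous (R : realType) n (M : 'M[R]_n) :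
  continuous (fun v : 'rV[R]_n => dot (v *m M) v).
Proof.
have coord i : continuous (fun v : 'rV[R]_n => v 0 i).
  exact: coord_continuous.
have sum (f : 'I_n -> 'rV[R]_n -> R) :
    (forall i, continuous (f i)) -> continuous (fun v => \sum_i f i v).
  move=> cf; elim: (index_enum _) => [|i s IHs] v.
    by under eq_fun do rewrite big_nil; exact: cst_continuous.
  under eq_fun do rewrite big_cons.
  by apply: continuousD; [exact: cf | exact: IHs].
have -> : (fun v : 'rV[R]_n => dot (v *m M) v) =
          (fun v => \sum_i \sum_j v 0 i * M i j * v 0 j).
  by apply/funext => v; exact: dot_mulmx.
apply: (sum) => i; apply: (sum) => j v.
apply: (@continuousM _ _ (fun w : 'rV[R]_n => w 0 i * M i j)).
  apply: (@continuousM _ _ (fun w : 'rV[R]_n => w 0 i) (cst (M i j))).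
    exact: coord.
  exact: cst_continuous.
exact: coord.
Qed.

(** Nonnegative entries let the maximum be sought among the nonnegative unit
    vectors only: taking absolute values of the coordinates of [y] keeps
    [dot y y] and cannot decrease the quadratic form.  That set is compact. *)
Lemma rayleigh_max (R : realType) n (M : 'M[R]_n) :
    (0 < n)%N -> (forall i j, 0 <= M i j) ->
  exists x : 'rV[R]_n, [/\ forall i, 0 <= x 0 i, dot x x = 1 &
    forall y, dot (y *m M) y <= dot (x *m M) x * dot y y].
Proof.
move=> n_gt0 M_ge0.
pose K : set 'rV[R]_n :=
  ([set v : 'rV[R]_n | forall i, `[0, 1]%classic (v ord0 i)] `&`
   [set v : 'rV[R]_n | dot v v = 1])%classic.
have K_compact : compact K.
  apply: (@compact_closedI 'rV[R]_n).
    apply: (@rV_compact R n (fun=> `[0, 1]%classic)) => _.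
    exact: segment_compact.
  apply: (@preimage_closed _ _ (fun v : 'rV[R]_n => dot v v) [set 1]%classic).
    move=> v _; have := @quadratic_form_continuous R n 1%:M v.
    by under eq_fun do rewrite mulmx1.
  exact: closed_eq.
have K_unit y : dot y y = 1 -> K (map_mx Num.norm y).
  move=> yy; split => /= [i|]; last first.
    rewrite -yy; apply: eq_bigr => i _.
    by rewrite mxE -normrM ger0_norm // -expr2 sqr_ge0.
  rewrite in_itv /= mxE normr_ge0 -(@expr_le1 _ 2) ?normr_ge0 //.
  rewrite real_normK ?num_real // -yy /dot (bigD1 i) //= expr2 lerDl.
  by apply: sumr_ge0 => j _; rewrite -expr2 sqr_ge0.
have K_nonempty : (K !=set0)%classic.
  exists (map_mx Num.norm (delta_mx 0 (Ordinal n_gt0))); apply: K_unit.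
  rewrite /dot (bigD1 (Ordinal n_gt0)) //= big1 ?addr0 => [|i ni].
    by rewrite mxE !eqxx mulr1.
  by rewrite mxE (negbTE ni) andbF mul0r.
have [x /set_mem [x01 xx] x_max] := compact_EVT_max K_nonempty K_compact
  (continuous_subspaceT (quadratic_form_continuous R n M)).
exists x; split => // [i|y].
  by have := x01 i; rewrite /= in_itv /= => /andP[].
have [->|y_neq0] := eqVneq y 0.
  by rewrite mul0mx !dot0r mulr0.
have yy_gt0 : 0 < dot y y by rewrite lt_neqAle eq_sym dot_eq0 y_neq0 dot_ge0.
set c := (Num.sqrt (dot y y))^-1.
have cc : c * c = (dot y y)^-1 by rewrite -invfM -expr2 sqr_sqrtr // ltW.
have /K_unit/mem_set/x_max : dot (c *: y) (c *: y) = 1.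
  by rewrite dotZl dotZr mulrA cc mulVf // gt_eqF.
rewrite -ler_pdivrMr // mulrC -cc; apply: le_trans.
rewrite !dot_mulmx mulr_sumr; apply: ler_sum => i _.
rewrite mulr_sumr; apply: ler_sum => j _; rewrite !mxE.
apply: (le_trans (ler_norm _)).
rewrite !normrM (ger0_norm (M_ge0 i j)).
by rewrite le_eqVlt; apply/orP; left; apply/eqP; ring.
Qed.

(** A maximizer of the Rayleigh quotient is an eigenvector because the first
    variation vanishes there, and its eigenvalue bounds all the others. *)
Lemma perron (R : realType) n (M : 'M[R]_n) :
    (0 < n)%N -> M^T = M -> (forall i j, 0 <= M i j) ->
  exists x : 'rV[R]_n, [/\ forall i, 0 <= x 0 i, x != 0 &
    x *m M = sup [set a | eigenvalue M a]%classic *: x].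
Proof.
move=> n_gt0 M_sym M_ge0.
have [x [x_ge0 xx x_max]] := rayleigh_max R n M n_gt0 M_ge0.
set r := dot (x *m M) x in x_max.
have x_neq0 : x != 0 by rewrite -dot_eq0 xx oner_neq0.
have xM : x *m M = r *: x.
  pose y := x *m M - r *: x.
  pose e := dot y y; pose c := r * e - dot (y *m M) y.
  suff : e = 0 by move/eqP; rewrite dot_eq0 subr_eq0 => /eqP.
  apply/eqP; rewrite eq_le dot_ge0 andbT leNgt; apply/negP => e_gt0.
  have eE : e = dot (x *m M) y - r * dot x y.
    by rewrite {1}/e {1}/y dotDl -scaleNr dotZl mulNr.
  (* maximality at [x], compared with the point [x + t *: y] *)
  have var t : 2 * t * e <= t ^+ 2 * c.
    have := x_max (x + t *: y).
    rewrite mulmxDl -scalemxAl !dotDl !dotDr !dotZl !dotZr.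
    rewrite (dot_mulmx_sym _ _ M y x M_sym) (dotC _ _ y x) xx -/r -/e /c.
    by rewrite eE; lra.
  (* a positive [t] this small makes the linear term dominate *)
  have := var (e / (`|c| + 1)).
  have c1_gt0 : 0 < `|c| + 1 by rewrite ltr_wpDl.
  set t := e / _; have t_gt0 : 0 < t by rewrite divr_gt0.
  have tc : t * (`|c| + 1) = e by rewrite divfK // gt_eqF.
  have := ler_norm c.
  move: tc t_gt0 e_gt0; move: (`|c|) => d; clear; nra.
suff -> : sup [set a | eigenvalue M a]%classic = r by exists x.
have r_eig : eigenvalue M r by apply/eigenvalueP; exists x.
have r_ub : ubound [set a | eigenvalue M a]%classic r.
  move=> a /= /eigenvalueP[v vM v_neq0]; have := x_max v.
  by rewrite vM dotZl ler_pM2r // lt_neqAle eq_sym dot_eq0 v_neq0 dot_ge0.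
apply/eqP; rewrite eq_le; apply/andP; split.
  by apply: ge_sup => //; exists r.
by apply: ub_le_sup => //; exists r.
Qed.

(** * Adjacency as a 0-1 weight *)

Definition adjn (R : realType) {G : sgraph} (u v : G) : R := (adj u v)%:R.

Lemma adjnC (R : realType) (G : sgraph) (u v : G) : adjn R u v = adjn R v u.
Proof. by rewrite /adjn adj_sym. Qed.

Lemma adjn01 (R : realType) (G : sgraph) (u v : G) :
  adjn R u v = 0 \/ adjn R u v = 1.
Proof. by rewrite /adjn; case: (adj u v); [right | left]. Qed.

Lemma adjn_ge0 (R : realType) (G : sgraph) (u v : G) : 0 <= adjn R u v.
Proof. by rewrite ler0n. Qed.

Lemma adjn_onem_ge0 (R : realType) (G : sgraph) (u v : G) :
  0 <= 1 - adjn R u v.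
Proof. by case: (adjn01 R G u v) => ->; rewrite ?subr0 ?subrr ?ler01. Qed.

Lemma perron_vector (R : realType) (G : sgraph) : (0 < #|G|)%N ->
  exists f : G -> R, [/\ forall u, 0 <= f u, exists u, 0 < f u &
    forall v, \sum_u f u * adjn R u v = spectral_radius R G * f v].
Proof.
move=> G_gt0; have [||x [x_ge0 x_neq0 xM]] :=
  perron R _ (adjacency_matrix R G) G_gt0.
- by apply/matrixP => i j; rewrite !mxE adj_sym.
- by move=> i j; rewrite mxE ler0n.
exists (fun u => x 0 (enum_rank u)); split => [//||v].
  have /rV0Pn[i xi] : x != 0 by [].
  by exists (enum_val i); rewrite enum_valK lt_neqAle eq_sym xi x_ge0.
have := congr1 (fun y : 'rV_ _ => y 0 (enum_rank v)) xM.
rewrite !mxE => <-.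
rewrite [LHS](reindex _ (onW_bij _ (@enum_val_bij G))) /=.
by apply: eq_bigr => i _; rewrite mxE enum_valK enum_rankK.
Qed.

(** Half of the handshake identity: each edge comes from at most two ordered
    pairs. *)
Lemma sum_adjn_le (R : realType) (G : sgraph) :
  \sum_(u : G) \sum_(v : G) adjn R u v <= (2 * #|edges G|)%:R.
Proof.
rewrite pair_bigA /= -natr_sum ler_nat -big_mkcond sum1_card.
pose pairs := [set p : G * G | adj p.1 p.2].
rewrite -(@eq_card _ (mem pairs)) => [|p]; last by rewrite inE.
rewrite -sum1_card (partition_big_imset (fun p : G * G => [set p.1; p.2])) /=.
have -> : [set [set p.1; p.2] | p in pairs] = edges G.
  by apply: eq_imset => // p; rewrite ?inE.
rewrite mulnC -sum_nat_const; apply: leq_sum => e /imsetP[[y z] /= _ ->].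
rewrite sum1dep_card.
apply: (leq_trans (subset_leq_card _) (_ : #|[set (y, z); (z, y)]| <= 2)%N).
  apply/fintype.subsetP => -[v w]; rewrite !inE /= => /andP[vw /eqP E].
  have v_neq_w : v != w by apply: contraTneq vw => ->; rewrite adj_irrefl.
  have : v \in [set y; z] by rewrite -E set21.
  have : w \in [set y; z] by rewrite -E set22.
  rewrite !inE !xpair_eqE => /orP[] /eqP w_eq /orP[] /eqP v_eq;
    by rewrite w_eq v_eq !eqxx ?orbT // in v_neq_w *.
by rewrite cards2; case: (_ != _).
Qed.

Lemma codegree_le_bk (R : realType) (G : sgraph) (y z : G) : adj y z ->
  \sum_w adjn R y w * adjn R z w <= (bk G)%:R.
Proof.
move=> yz; have -> : \sum_w adjn R y w * adjn R z w =
    #|common_neighbours y z|%:R.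
  rewrite -sum1dep_card natr_sum [RHS]big_mkcond /=.
  by apply: eq_bigr => w _; rewrite -natrM mulnb; case: (_ && _).
by rewrite ler_nat; exact: (leq_bigmax_cond (y, z)).
Qed.

(** * Edges inside and outside a neighbourhood *)

Lemma sum3_rot (R : realType) (T : finType) (F : T -> T -> T -> R) :
  \sum_y \sum_z \sum_w F y z w = \sum_y \sum_z \sum_w F z w y.
Proof.
rewrite [RHS]exchange_big; apply: eq_bigr => y _.
by rewrite [RHS]exchange_big.
Qed.

Lemma sum3_eq0 (R : realType) (T : finType) (F : T -> T -> T -> R) :
    (forall u y z, 0 <= F u y z) ->
  \sum_u \sum_y \sum_z F u y z = 0 -> forall u y z, F u y z = 0.
Proof.
move=> F_ge0 F0 u y z.
have sum1 : \sum_y \sum_z F u y z = 0.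
  by apply: (psumr_eq0P _ F0) => // v _; do 2![apply: sumr_ge0 => ? _].
have sum2 : \sum_z F u y z = 0.
  by apply: (psumr_eq0P _ sum1) => // v _; apply: sumr_ge0.
exact: (psumr_eq0P _ sum2).
Qed.

Definition inner_weight {R : realType} {G : sgraph} (f : G -> R) : R :=
  \sum_u \sum_y \sum_z f u * (adjn R u y * adjn R u z * adjn R y z).

Definition outer_weight {R : realType} {G : sgraph} (f : G -> R) : R :=
  \sum_u \sum_y \sum_z
    f u * ((1 - adjn R u y) * (1 - adjn R u z) * adjn R y z).

Lemma inner_term_ge0 (R : realType) (G : sgraph) (f : G -> R) :
    (forall u, 0 <= f u) ->
  forall u y z, 0 <= f u * (adjn R u y * adjn R u z * adjn R y z).
Proof. by move=> f_ge0 u y z; rewrite !mulr_ge0 ?adjn_ge0. Qed.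

Lemma outer_term_ge0 (R : realType) (G : sgraph) (f : G -> R) :
    (forall u, 0 <= f u) ->
  forall u y z, 0 <= f u * ((1 - adjn R u y) * (1 - adjn R u z) * adjn R y z).
Proof.
by move=> f_ge0 u y z; rewrite !mulr_ge0 ?adjn_onem_ge0 ?adjn_ge0.
Qed.

Lemma inner_weight_ge0 (R : realType) (G : sgraph) (f : G -> R) :
  (forall u, 0 <= f u) -> 0 <= inner_weight f.
Proof.
by move=> f_ge0; do 3![apply: sumr_ge0 => ? _]; exact: inner_term_ge0.
Qed.

Lemma outer_weight_ge0 (R : realType) (G : sgraph) (f : G -> R) :
  (forall u, 0 <= f u) -> 0 <= outer_weight f.
Proof.
by move=> f_ge0; do 3![apply: sumr_ge0 => ? _]; exact: outer_term_ge0.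
Qed.

(** Since [p q - (1 - p)(1 - q) = p + q - 1], the difference counts walks
    [u - y - z] of length two, each worth [r ^ 2] after weighting by the
    eigenvector, against all edges.  This is Nosal's argument. *)
Lemma inner_weight_sub_outer (R : realType) (G : sgraph) (f : G -> R) (r : R) :
    (forall v, \sum_u f u * adjn R u v = r * f v) ->
  inner_weight f - outer_weight f =
    (\sum_u f u) * (2 * r ^+ 2 - \sum_(y : G) \sum_(z : G) adjn R y z).
Proof.
move=> f_eigen.
have walks : \sum_u \sum_y \sum_z f u * (adjn R u y * adjn R y z) =
    (\sum_u f u) * r ^+ 2.
  rewrite sum3_rot mulr_suml; apply: eq_bigr => z _; rewrite exchange_big /=.
  transitivity (\sum_y r * (f y * adjn R y z)).
    apply: eq_bigr => y _; rewrite mulrA -f_eigen mulr_suml.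
    by apply: eq_bigr => u _; rewrite mulrA.
  by rewrite -mulr_sumr f_eigen; ring.
have -> : inner_weight f - outer_weight f =
    \sum_u \sum_y \sum_z (f u * (adjn R u y * adjn R y z) +
      f u * (adjn R u z * adjn R z y) - f u * adjn R y z).
  rewrite -sumrB; apply: eq_bigr => u _; rewrite -sumrB; apply: eq_bigr => y _.
  rewrite -sumrB; apply: eq_bigr => z _; rewrite (adjnC R G z y); ring.
under eq_bigr => u _ do under eq_bigr => y _ do rewrite sumrB big_split /=.
under eq_bigr => u _ do rewrite sumrB big_split /=.
rewrite sumrB big_split /= walks.
have -> : \sum_u \sum_y \sum_z f u * (adjn R u z * adjn R z y) =
    (\sum_u f u) * r ^+ 2.
  by rewrite -walks; apply: eq_bigr => u _; exact: exchange_big.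
have -> : \sum_u \sum_(y : G) \sum_(z : G) f u * adjn R y z =
    (\sum_u f u) * \sum_(y : G) \sum_(z : G) adjn R y z.
  rewrite mulr_suml; apply: eq_bigr => u _; rewrite mulr_sumr.
  by apply: eq_bigr => y _; rewrite mulr_sumr.
ring.
Qed.

(** * Triangles seen from a vertex *)

Definition triangle (R : realType) {G : sgraph} (y z w : G) : R :=
  adjn R y z * adjn R z w * adjn R y w.

Lemma triangle_ge0 (R : realType) (G : sgraph) (y z w : G) :
  0 <= triangle R y z w.
Proof. by rewrite !mulr_ge0 ?adjn_ge0. Qed.

Lemma triangle_rot (R : realType) (G : sgraph) (y z w : G) :
  triangle R z w y = triangle R y z w.
Proof. rewrite /triangle !(adjnC R G _ y); ring. Qed.

Lemma sum_triangle_rot3 (R : realType) (G : sgraph) (h : G -> G -> G -> R) :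
  3 * (\sum_y \sum_z \sum_w triangle R y z w * h y z w) =
  \sum_y \sum_z \sum_w triangle R y z w * (h y z w + h z w y + h w y z).
Proof.
under [RHS]eq_bigr => y _ do under eq_bigr => z _ do
  (under eq_bigr => w _ do rewrite !mulrDr; rewrite !big_split /=).
under [RHS]eq_bigr => y _ do rewrite !big_split /=.
rewrite !big_split /=.
have rot (k : G -> G -> G -> R) :
    \sum_y \sum_z \sum_w triangle R y z w * k z w y =
    \sum_y \sum_z \sum_w triangle R y z w * k y z w.
  rewrite [RHS](sum3_rot R G (fun y z w => triangle R y z w * k y z w)) /=.
  apply: eq_bigr => y _; apply: eq_bigr => z _.
  by apply: eq_bigr => w _; rewrite (triangle_rot R G y z w).
rewrite (rot h) (rot (fun y z w => h z w y)) (rot h); ring.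
Qed.

(** For a single triangle the inequality symmetrized over its corners is the
    one with [p], [q], [s]: according as [u] sees 0, 1, 2 or 3 corners, it
    reads 0 <= 3, 1 <= 1, 2 <= 2 or 3 <= 6.  In a blow-up of the triangular
    prism only the two cases of equality occur, and the largest book has size
    exactly a third of the spectral radius. *)
Lemma triangle_corners_le (R : realType) (G : sgraph) (u : G) :
  \sum_y \sum_z \sum_w triangle R y z w * adjn R u y <=
    2 * (\sum_y \sum_z \sum_w
           triangle R y z w * (adjn R u y * adjn R u z)) +
    \sum_y \sum_z \sum_w
      triangle R y z w * ((1 - adjn R u y) * (1 - adjn R u z)).
Proof.
rewrite -(ler_pM2l (_ : 0 < 3)) ?ltr0n // mulrDr mulrCA !sum_triangle_rot3.
rewrite mulr_sumr -big_split; apply: ler_sum => y _ /=.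
rewrite mulr_sumr -big_split; apply: ler_sum => z _ /=.
rewrite mulr_sumr -big_split; apply: ler_sum => w _ /=.
rewrite mulrCA -mulrDr; apply: ler_wpM2l; first exact: triangle_ge0.
by case: (adjn01 R G u y) => ->; case: (adjn01 R G u z) => ->;
  case: (adjn01 R G u w) => ->; lra.
Qed.

(** The third corner [w] of a triangle is a page of the book on [yz], so it
    contributes a factor at most [bk G] to any weight independent of [w]. *)
Lemma sum_pages_le (R : realType) (G : sgraph) (f : G -> R)
    (h : G -> G -> G -> R) :
    (forall u, 0 <= f u) -> (forall u y z, 0 <= h u y z) ->
  \sum_u f u * (\sum_y \sum_z \sum_w triangle R y z w * h u y z) <=
    (bk G)%:R * \sum_u \sum_y \sum_z f u * (h u y z * adjn R y z).
Proof.
move=> f_ge0 h_ge0; rewrite mulr_sumr; apply: ler_sum => u _.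
rewrite !mulr_sumr; apply: ler_sum => y _.
rewrite !mulr_sumr; apply: ler_sum => z _.
have -> : \sum_w triangle R y z w * h u y z =
    h u y z * (adjn R y z * \sum_w adjn R y w * adjn R z w).
  by rewrite !mulr_sumr; apply: eq_bigr => w _; rewrite /triangle; ring.
rewrite [leRHS]mulrCA; apply: ler_wpM2l; first exact: f_ge0.
rewrite [leRHS]mulrCA; apply: ler_wpM2l; first exact: h_ge0.
rewrite {1 4}/adjn; case: (boolP (adj y z)) => [yz|_].
  by rewrite mul1r mulr1 codegree_le_bk.
by rewrite mul0r mulr0.
Qed.

(** The eigenvector equation is used at a corner [y]: the total weight of the
    vertices adjacent to [y] is [r * f y]. *)
Lemma book_inequality (R : realType) (G : sgraph) (f : G -> R) (r : R) :
    (forall u, 0 <= f u) ->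
    (forall v, \sum_u f u * adjn R u v = r * f v) ->
  r * inner_weight f <= (bk G)%:R * (2 * inner_weight f + outer_weight f).
Proof.
move=> f_ge0 f_eigen.
have -> : r * inner_weight f =
    \sum_u f u * (\sum_y \sum_z \sum_w triangle R y z w * adjn R u y).
  under [RHS]eq_bigr => u _ do rewrite mulr_sumr.
  rewrite [RHS]exchange_big mulr_sumr; apply: eq_bigr => y _ /=.
  under [RHS]eq_bigr => u _ do rewrite mulr_sumr.
  rewrite [RHS]exchange_big mulr_sumr; apply: eq_bigr => z _ /=.
  under [RHS]eq_bigr => u _ do rewrite mulr_sumr.
  rewrite [RHS]exchange_big mulr_sumr; apply: eq_bigr => w _ /=.
  rewrite mulrA -f_eigen mulr_suml; apply: eq_bigr => u _.
  by rewrite /triangle; ring.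
have inner_le := sum_pages_le R G f (fun u y z => adjn R u y * adjn R u z)
  f_ge0 (fun u y z => mulr_ge0 (adjn_ge0 R G u y) (adjn_ge0 R G u z)).
have outer_le := sum_pages_le R G f
  (fun u y z => (1 - adjn R u y) * (1 - adjn R u z)) f_ge0
  (fun u y z => mulr_ge0 (adjn_onem_ge0 R G u y) (adjn_onem_ge0 R G u z)).
apply: (@le_trans _ _
    (2 * (\sum_u f u * (\sum_y \sum_z \sum_w
            triangle R y z w * (adjn R u y * adjn R u z))) +
     \sum_u f u * (\sum_y \sum_z \sum_w
            triangle R y z w * ((1 - adjn R u y) * (1 - adjn R u z))))).
  rewrite mulr_sumr -big_split; apply: ler_sum => u _ /=.
  by rewrite mulrCA -mulrDr ler_wpM2l ?triangle_corners_le.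
rewrite mulrDr mulrCA; apply: lerD; last exact: outer_le.
by rewrite ler_wpM2l ?inner_le.
Qed.

(** * The degenerate case *)

Lemma complete_bipartite_of_parts (G : sgraph) (A : {set G}) (a0 b0 : G) :
    a0 \in A -> b0 \notin A ->
    (forall y z, adj y z = ((y \in A) != (z \in A))) ->
  isomorphic G (complete_bipartite #|A| #|~: A|).
Proof.
move=> a0A; rewrite -finset.in_setC => b0B adjE.
pose g y : 'I_#|A| + 'I_#|~: A| :=
  if y \in A then inl (enum_rank_in a0A y) else inr (enum_rank_in b0B y).
have g_inj : injective g.
  move=> y z; rewrite /g.
  case: (boolP (y \in A)) => yA; case: (boolP (z \in A)) => zA //.
    by case=> /(congr1 enum_val); rewrite !enum_rankK_in.
  rewrite -!finset.in_setC in yA zA.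
  by case=> /(congr1 enum_val); rewrite !enum_rankK_in.
exists g; last by move=> y z; rewrite adjE /g; case: (y \in A); case: (z \in A).
apply: inj_card_bij => //.
by rewrite card_sum !card_ord finset.cardsC.
Qed.

(** Start from [u0] with [f u0 > 0]: its neighbourhood and the complement of
    that neighbourhood are independent.  The neighbours [y] of [u0] also have
    positive weight, so their non-neighbourhoods are independent too.  If [z]
    lies on the side of [u0] but is not adjacent to [y], then any neighbour of
    [z] is on the side of [y], and gives an edge outside [N(y)]. *)
Lemma complete_bipartite_of_weights (R : realType) (G : sgraph) (f : G -> R)
    (r : R) (u0 : G) :
    (forall u, 0 <= f u) ->
    (forall v, \sum_u f u * adjn R u v = r * f v) ->
    no_isolated_vertex G -> 0 < f u0 ->
    inner_weight f = 0 -> outer_weight f = 0 ->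
  exists s t, [/\ (0 < s)%N, (0 < t)%N & isomorphic G (complete_bipartite s t)].
Proof.
move=> f_ge0 f_eigen no_isol fu0 inner0 outer0.
have nbrs_indep u y z : 0 < f u -> adj u y -> adj u z -> ~~ adj y z.
  move=> fu uy uz.
  have := sum3_eq0 _ _ _ (inner_term_ge0 R G f f_ge0) inner0 u y z.
  rewrite /adjn uy uz !mul1r => /eqP.
  by rewrite mulf_eq0 gt_eqF //= pnatr_eq0 eqb0.
have far_indep u y z : 0 < f u -> ~~ adj u y -> ~~ adj u z -> ~~ adj y z.
  move=> fu /negbTE uy /negbTE uz.
  have := sum3_eq0 _ _ _ (outer_term_ge0 R G f f_ge0) outer0 u y z.
  rewrite /adjn uy uz !subr0 !mul1r => /eqP.
  by rewrite mulf_eq0 gt_eqF //= pnatr_eq0 eqb0.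
have f_nbr v : adj u0 v -> 0 < f v.
  move=> uv; have rfv : 0 < r * f v.
    rewrite -f_eigen (bigD1 u0) //= /adjn uv mulr1 ltr_wpDr //.
    by apply: sumr_ge0 => w _; rewrite mulr_ge0 ?ler0n.
  rewrite lt_neqAle f_ge0 andbT.
  by apply: contraTneq rfv => <-; rewrite mulr0 ltxx.
have cross y z : adj u0 y -> ~~ adj u0 z -> adj y z.
  move=> uy uz; apply: contraT => yz; have [w zw] := no_isol z.
  have uw : adj u0 w by apply: contraTT zw => uw; exact: far_indep uz uw.
  have yw : ~~ adj y w by exact: nbrs_indep uy uw.
  by have := far_indep y z w (f_nbr y uy) yz yw; rewrite zw.
pose A := [set v | adj u0 v].
have [v0 uv0] := no_isol u0.
have v0A : v0 \in A by rewrite inE.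
have u0A : u0 \notin A by rewrite inE adj_irrefl.
exists #|A|, #|~: A|; split.
- by apply/card_gt0P; exists v0.
- by apply/card_gt0P; exists u0; rewrite finset.in_setC.
apply: (complete_bipartite_of_parts G A v0 u0) => // y z; rewrite !inE.
case: (boolP (adj u0 y)) => uy; case: (boolP (adj u0 z)) => uz /=.
- by apply/negbTE; exact: nbrs_indep uy uz.
- exact: cross.
- by rewrite adj_sym; exact: cross.
- by apply/negbTE; exact: far_indep uy uz.
Qed.

(** * Books and the spectral radius *)

Theorem theorem1p10 (R : realType) (G : sgraph) (m : nat)
  (G_nonempty : (0 < #|G|)%N)
  (G_size : #|edges G| = m)
  (G_isol : no_isolated_vertex G)
  (G_rho : Num.sqrt (m%:R : R) <= spectral_radius R G)
  (G_not_Kst : forall s t : nat, (0 < s)%N -> (0 < t)%N ->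
     ~ isomorphic G (complete_bipartite s t)) :
  spectral_radius R G / 3 <= (bk G)%:R.
Proof.
have [f [f_ge0 [u0 fu0] f_eigen]] := perron_vector R G G_nonempty.
set r := spectral_radius R G in G_rho f_eigen *.
have m_le : m%:R <= r ^+ 2.
  rewrite -[X in X <= _](@sqr_sqrtr R) ?ler0n //.
  by rewrite ler_pXn2r ?nnegrE ?sqrtr_ge0 // (le_trans _ G_rho) ?sqrtr_ge0.
have outer_le : outer_weight f <= inner_weight f.
  rewrite -subr_ge0 (inner_weight_sub_outer _ _ _ r) //; apply: mulr_ge0.
    exact: sumr_ge0.
  rewrite subr_ge0; apply: (le_trans (sum_adjn_le R G)).
  by rewrite G_size natrM ler_wpM2l.
have count := book_inequality R G f r f_ge0 f_eigen.
have := inner_weight_ge0 R G f f_ge0.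
rewrite le_eqVlt => /orP[/eqP inner0|inner_gt0].
  have outer0 : outer_weight f = 0.
    by apply/eqP; rewrite eq_le outer_weight_ge0 // andbT inner0.
  have [s [t [s_gt0 t_gt0 iso]]] := complete_bipartite_of_weights R G f r u0
    f_ge0 f_eigen G_isol fu0 (esym inner0) outer0.
  by case: (G_not_Kst s t).
rewrite ler_pdivrMr ?ltr0n // -(ler_pM2r inner_gt0).
apply: (le_trans count); rewrite -mulrA ler_wpM2l ?ler0n //.
by move: outer_le; lra.
Qed.
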